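(* There exist absolute constants $c\ge 1$ and $C>0$ such that the following holds for all $D,n\ge 1$. In the arrival-only model with $D$ divisible resources and Cobb-Douglas rates with the proportionally fair allocation $I_d(j,t)=\alpha_{jd}/\sum_{k\in N^t}\alpha_{kd}$, there is an online allocation policy which, on every instance with $n$ arriving jobs, is feasible in every resource, gives every alive job $j$ at every time $t$ a rate that is at least $1/c$ times its rate under the proportionally fair allocation, and makes at most $C\, n D\log^* n$ disruptions in total.
   Context: Model. There are $D$ divisible resources, each with unit supply. $N^t$ denotes the set of alive jobs at time $t$; in the arrival-only model $N^{t-1}\subseteq N^t$ for all $t$. Each job $j$ has a substitutability vector $(\alpha_{jd})_{d=1}^D$ with $\alpha_{jd}\ge 0$ and $\sum_{d=1}^D\alpha_{jd}=1$, revealed on its arrival. Given amounts $x_{jd}\ge 0$ of the resources $d\in[D]$, the (Cobb-Douglas) rate of job $j$ is $y_j=\prod_{d=1}^D x_{jd}^{\alpha_{jd}}$ (with $0^0=1$). The proportionally fair allocation maximizes $\prod_{j\in N^t} y_j$ and is given by $x_{jd}=I_d(j,t)=\alpha_{jd}/\sum_{k\in N^t}\alpha_{kd}$ (taken to be $0$ if the denominator is $0$). An online allocation policy chooses at each time $t$ amounts $A_d(j,t)\ge 0$ for $j\in N^t$, $d\in[D]$, depending only on what has been revealed up to time $t$ (the total number $n$ of jobs is assumed known a priori); it is feasible if $\sum_{j\in N^t}A_d(j,t)\le 1$ for all $d,t$. A disruption is a triple $(j,d,t)$ with $j\in N^{t-1}\cap N^t$ and $A_d(j,t)\ne A_d(j,t-1)$.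 $\log^*$ is the iterated (base-2) logarithm. *)

(* Defs.v *)
From HB Require Import structures.
From mathcomp Require Import all_boot all_order all_algebra.
From mathcomp Require Import all_classical all_reals all_analysis.
Set Implicit Arguments.
Unset Strict Implicit.
Unset Printing Implicit Defensive.
Import Order.TTheory GRing.Theory Num.Theory.
Local Open Scope ring_scope.

Definition log2 (R : realType) (x : R) : R := ln x / ln 2.

Lemma logstar_exists (R : realType) (x : R) :
  exists k, iter k (@log2 R) x <= 1.
Proof.
have ln2_gt0 : 0 < ln (2 : R) by apply: ln_gt0; rewrite ltr1n.
pose tower k := iter k (fun m : nat => (2 ^ m)%N) 1%N.
have le_tower k : (k <= tower k)%N.
  by elim: k => // k IHk /=; apply: leq_ltn_trans IHk _; exact: ltn_expl.
have below k : forall y : R, y <= (tower k)%:R ->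
    exists i, iter i (@log2 R) y <= 1.
  elim: k => [|k IHk] y ley; first by exists 0%N.
  have [y_le1|y_gt1] := leP y 1; first by exists 0%N.
  have [|i ilogy] := IHk (log2 y); last by exists i.+1; rewrite iterSr.
  rewrite /log2 ler_pdivrMr // mulr_natl -lnXn // ler_ln ?posrE ?exprn_gt0 //.
    by rewrite -natrX.
  exact: lt_trans y_gt1.
have [m x_lt] : exists m : nat, x < m%:R.
  exists (Num.bound `|x|).
  exact: le_lt_trans (ler_norm x) (archi_boundP (normr_ge0 x)).
by apply: (below m); apply: le_trans (ltW x_lt) _; rewrite ler_nat.
Qed.

(* The least number of iterations of log2 that brings x to a value <= 1;
   in particular logstar 1 = 0 and logstar 2 = 1. *)
Definition logstar (R : realType) (x : R) : nat := ex_minn (logstar_exists x).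

(* Jobs are named by 'I_n and time ranges over nat. Every job arrives at some
   time, so that exactly n jobs arrive; several jobs may arrive at once, and
   alive 0 is arbitrary. *)
Record instance (R : realType) (D n : nat) := Instance {
  alive : nat -> {set 'I_n};
  alpha : 'I_n -> 'I_D -> R;
  alive_subS : forall t, alive t \subset alive t.+1;
  alive_arrives : forall j, exists t, j \in alive t;
  alpha_ge0 : forall j d, 0 <= alpha j d;
  alpha_sum1 : forall j, \sum_(d < D) alpha j d = 1
}.

(* [A t j d] is the amount A_d(j,t); it is meaningful only for j alive at t. *)
Definition allocation (R : realType) (D n : nat) := nat -> 'I_n -> 'I_D -> R.

(* Relies on 0 `^ 0 = 1 and 0 `^ a = 0 for a != 0. *)
Definition rate (R : realType) (D : nat) (a x : 'I_D -> R) : R :=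
  \prod_(d < D) x d `^ a d.

(* Division by zero yields 0. *)
Definition prop_fair (R : realType) (D n : nat) (I : instance R D n) :
    allocation R D n :=
  fun t j d => alpha I j d / \sum_(k in alive I t) alpha I k d.

Definition feasible (R : realType) (D n : nat) (I : instance R D n)
    (A : allocation R D n) : Prop :=
  (forall t j d, j \in alive I t -> 0 <= A t j d) /\
  (forall t d, \sum_(j in alive I t) A t j d <= 1).

Definition policy (R : realType) (D n : nat) :=
  instance R D n -> allocation R D n.

Definition same_history (R : realType) (D n : nat) (t : nat)
    (I I' : instance R D n) : Prop :=
  (forall s, (s <= t)%N -> alive I s = alive I' s) /\
  (forall j d, j \in alive I t -> alpha I j d = alpha I' j d).

Definition online (R : realType) (D n : nat) (P : policy R D n) : Prop :=
  forall t (I I' : instance R D n), same_history t I I' ->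
    forall j d, j \in alive I t -> P I t j d = P I' t j d.

(* The element (j, d, t) stands for the disruption (j, d, t.+1), that is, a
   change between times t and t.+1; T is the last time considered. *)
Definition disruptions (R : realType) (D n : nat) (I : instance R D n)
    (A : allocation R D n) (T : nat) : {set 'I_n * 'I_D * 'I_T} :=
  [set p : 'I_n * 'I_D * 'I_T | let: (j, d, t) := p in
    (j \in alive I t :&: alive I t.+1) && (A t.+1 j d != A t j d)].

(* Main.v *)
Require Import Defs.
From mathcomp Require Import all_boot all_order all_algebra.
From mathcomp Require Import all_classical all_reals all_analysis.
From mathcomp Require Import ring lra.
Import Order.TTheory GRing.Theory Num.Theory.
Local Open Scope ring_scope.

(** Each resource is treated separately, with [w j] the weight of job [j] in it
  and [S t] the total weight alive at time [t]. If [j] arrives at time [s], it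
  receives [w j / S s * g (S t / S s)] up to a constant factor, where [g] is a
  decreasing step function with [1 / x <= g x], so that [j] always has at least
  a constant fraction of [w j / S t]. Jobs whose arrival load [S s] is at least
  [S t / T] satisfy [\sum w j / S s <= 1 + ln T], because an arriving batch
  contributes [1 - S s.-1 / S s <= ln (S s / S s.-1)]. Hence a step of height
  [1 / T i] that extends up to [T i.+1] costs [(1 + ln (T i.+1)) / T i], which is
  summable even if [T] grows like a tower of exponentials. Once [T m >= n] a
  last, infinite step of height [1 / T m] costs at most [1], and [m = log* n]
  thresholds suffice. *)

Set Implicit Arguments.
Unset Strict Implicit.
Unset Printing Implicit Defensive.

(** * Towers of exponentials and the iterated logarithm *)

Definition tower (k : nat) : nat := iter k (expn 2) 1%N.

Lemma tower_gt k : (k < tower k)%N.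
Proof. by elim: k => // k IHk; exact: leq_trans (ltn_expl _ _). Qed.

Lemma exp2_le_tower k : (2 ^ k <= tower k)%N.
Proof. by case: k => // k; rewrite /tower iterS leq_exp2l // tower_gt. Qed.

Lemma le_tower_iter_log2 (R : realType) k (x : R) :
  iter k (@log2 R) x <= 1 -> x <= (tower k)%:R.
Proof.
elim: k x => [//|k IHk] x; rewrite iterSr => /IHk.
have ln2_gt0 : 0 < ln (2 : R) by apply: ln_gt0; rewrite ltr1n.
rewrite /log2 ler_pdivrMr // mulr_natl -lnXn // -natrX => le_ln.
(* For nonpositive [x] the comparison of logarithms carries no information. *)
have [x_le0|x_gt0] := leP x 0; first exact: le_trans x_le0 (ler0n _ _).
by move: le_ln; rewrite ler_ln ?posrE // ltr0n expn_gt0.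
Qed.

Lemma le_tower_logstar (R : realType) (x : R) : x <= (tower (logstar x))%:R.
Proof. by rewrite /logstar; case: ex_minnP => k /le_tower_iter_log2. Qed.

Definition threshold (R : realType) (i : nat) : R := (tower i)%:R ^+ 2.

(** * The decreasing step function and its cost *)

Definition step (R : realType) (m : nat) (x : R) : R :=
  \sum_(i < m) (x <= threshold R i.+1)%R%:R / threshold R i + (threshold R m)^-1.

Lemma tower_ge1 (R : realType) i : 1 <= (tower i)%:R :> R.
Proof. by rewrite ler1n; exact: leq_ltn_trans (leq0n i) (tower_gt i). Qed.

Lemma threshold_ge1 (R : realType) i : 1 <= threshold R i.
Proof. exact: exprn_ege1 (tower_ge1 R i). Qed.

Lemma threshold_gt0 (R : realType) i : 0 < threshold R i.
Proof. exact: lt_le_trans ltr01 (threshold_ge1 R i). Qed.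

Lemma step_ge0 (R : realType) m (x : R) : 0 <= step m x.
Proof.
rewrite addr_ge0 ?invr_ge0 ?(ltW (threshold_gt0 _ _))// sumr_ge0 // => i _.
by rewrite divr_ge0 ?ler0n // (ltW (threshold_gt0 _ _)).
Qed.

(** Induction on [m]: up to [T m.+1] the old constant [1 / T m] survives as an active indicator, so
    the value does not drop; beyond, the new constant [1 / T m.+1] alone suffices. *)
Lemma le_inv_step (R : realType) m (x : R) : 1 <= x -> x^-1 <= step m x.
Proof.
move=> x_ge1; have x_gt0 : 0 < x := lt_le_trans ltr01 x_ge1.
elim: m => [|m IHm].
  by rewrite /step big_ord0 add0r /threshold expr1n invr1 invf_le1.
rewrite /step big_ord_recr /=; case: (leP x) => [_|lt_x].
  rewrite mulr1n mul1r; apply: le_trans IHm _; rewrite lerDl invr_ge0.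
  exact: ltW (threshold_gt0 _ _).
rewrite ler_wpDl ?lef_pV2 ?posrE ?threshold_gt0 ?(ltW lt_x)//.
rewrite mulr0n mul0r addr0 sumr_ge0 // => i _.
by rewrite divr_ge0 ?ler0n // (ltW (threshold_gt0 _ _)).
Qed.

Lemma step_crossing (R : realType) m (x y : R) :
  x <= y -> step m x != step m y ->
  exists i : 'I_m, (x <= threshold R i.+1 < y)%R.
Proof.
move=> le_xy /eqP neq; apply/existsP; apply: contraT => /existsPn no; case: neq.
congr (_ + _); apply: eq_bigr => i _; congr (_%:R / _).
have := no i; rewrite negb_and -leNgt -ltNge.
case: (leP y) => [ley _|lty /=]; first by rewrite (le_trans le_xy ley).
by rewrite orbF ltNge => /negbTE ->.
Qed.

(** With [x = tower i], squaring in [threshold] bounds a term by [(1 + 2 * x) / x ^+ 2 <= 3 / x],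
    and [x >= 2 ^ i] gives a geometric series; unsquared towers would leave terms above [ln 2]. *)
Lemma step_cost (R : realType) m :
  \sum_(i < m) (1 + ln (threshold R i.+1)) / threshold R i <= 6.
Proof.
have ln2_ge0 : 0 <= ln (2 : R) by rewrite ln_ge0 ?ler1n.
have ln2_le1 : ln (2 : R) <= 1.
  by rewrite [2](_ : _ = 1 + 1 :> R) ?le_ln1Dx //; lra.
have term i : (1 + ln (threshold R i.+1)) / threshold R i <= 3 * 2^-1 ^+ i.
  have t1 := tower_ge1 R i; set x : R := (tower i)%:R in t1 *.
  have x_gt0 : 0 < x by rewrite (lt_le_trans ltr01).
  have lnT : ln (threshold R i.+1) <= 2 * x.
    rewrite /threshold /tower iterS -/(tower i) natrX -exprM lnXn ?ltr0n //.
    rewrite -[leLHS]mulr_natl natrM -/x.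
    nra.
  apply: (@le_trans _ _ (3 / x)).
    rewrite ler_pdivrMr ?threshold_gt0 // /threshold -/x expr2.
    by rewrite mulrA divfK ?gt_eqF //; lra.
  rewrite ler_pM2l ?ltr0n // exprVn lef_pV2 ?posrE ?exprn_gt0 //.
  by rewrite -natrX ler_nat exp2_le_tower.
(* The exact geometric sum is needed for the induction on [m]. *)
apply: (@le_trans _ _ (6 * (1 - 2^-1 ^+ m))); last first.
  by rewrite ler_piMr // lerBlDr lerDl exprn_ge0.
elim: m => [|m IHm]; first by rewrite big_ord0 expr0 subrr mulr0.
rewrite big_ord_recr /=; apply: le_trans (lerD IHm (term m)) _.
by rewrite exprS; lra.
Qed.

(** * Arrival times, loads and shares *)

Definition arrival (R : realType) D n (I : instance R D n) (j : 'I_n) : nat :=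
  ex_minn (alive_arrives I j).

Definition load (R : realType) D n (I : instance R D n) (d : 'I_D) t : R :=
  \sum_(k in alive I t) alpha I k d.

Definition arrival_load (R : realType) D n (I : instance R D n) d j : R :=
  load I d (arrival I j).

Lemma alive_sub (R : realType) D n (I : instance R D n) s t :
  (s <= t)%N -> alive I s \subset alive I t.
Proof.
move=> /subnKC <-; elim: (t - s)%N => [|k IHk]; first by rewrite addn0.
by rewrite addnS; exact: fintype.subset_trans IHk (alive_subS I _).
Qed.

Lemma arrival_le (R : realType) D n (I : instance R D n) t j :
  (arrival I j <= t)%N = (j \in alive I t).
Proof.
rewrite /arrival; case: ex_minnP => s sj smin; apply/idP/idP => [le_st|].
  exact: (fintype.subsetP (alive_sub I le_st)).
exact: smin.
Qed.

Lemma load_ge0 (R : realType) D n (I : instance R D n) d t : 0 <= load I d t.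
Proof. by apply: sumr_ge0 => k _; exact: alpha_ge0. Qed.

Lemma load_split (R : realType) D n (I : instance R D n) d s t :
  (s <= t)%N ->
  load I d t = load I d s + \sum_(k in alive I t :\: alive I s) alpha I k d.
Proof.
by move=> le_st; rewrite /load (big_setID (alive I s)) (finset.setIidPr (alive_sub I le_st)).
Qed.

Lemma load_le (R : realType) D n (I : instance R D n) d s t :
  (s <= t)%N -> load I d s <= load I d t.
Proof.
move=> le_st; rewrite (load_split I d le_st) lerDl sumr_ge0 // => k _.
exact: alpha_ge0.
Qed.

Lemma alpha_le_load (R : realType) D n (I : instance R D n) d t j :
  j \in alive I t -> alpha I j d <= load I d t.
Proof.
move=> jt; rewrite /load (bigD1 j) //= lerDl sumr_ge0 // => k _.
exact: alpha_ge0.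
Qed.

Lemma alpha_le_arrival_load (R : realType) D n (I : instance R D n) d j :
  alpha I j d <= arrival_load I d j.
Proof. by apply: alpha_le_load; rewrite -arrival_le. Qed.

Lemma arrival_load_le (R : realType) D n (I : instance R D n) d t j :
  j \in alive I t -> arrival_load I d j <= load I d t.
Proof. by rewrite -arrival_le => ?; exact: load_le. Qed.

(** The proportionally fair amount at the moment of arrival. *)
Definition arrival_share (R : realType) D n (I : instance R D n) d j : R :=
  alpha I j d / arrival_load I d j.

Lemma arrival_share_ge0 (R : realType) D n (I : instance R D n) d j :
  0 <= arrival_share I d j.
Proof. by rewrite divr_ge0 ?alpha_ge0 ?load_ge0. Qed.

Lemma arrival_share_le1 (R : realType) D n (I : instance R D n) d j :
  arrival_share I d j <= 1.
Proof.
have := load_ge0 I d (arrival I j); rewrite le_eqVlt => /predU1P[S0|S_gt0].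
  by rewrite /arrival_share /arrival_load -S0 invr0 mulr0 ler01.
by rewrite /arrival_share ler_pdivrMr // mul1r alpha_le_arrival_load.
Qed.

(** * Logarithmic bounds on sums of shares *)

Lemma one_sub_div_le_ln (R : realType) (x y : R) :
  0 < x -> 0 < y -> (y - x) / y <= ln (y / x).
Proof.
move=> x0 y0.
have xy0 : 0 < x / y by rewrite divr_gt0.
have lnxy : ln (x / y) <= x / y - 1.
  by have := @le_ln1Dx R (x / y - 1); rewrite [1 + _]addrC subrK; apply; lra.
rewrite -[y / x]invf_div lnV ?posrE // mulrBl divff ?gt_eqF //; lra.
Qed.

(** The logarithms telescope over the batches arriving after the load has reached [s]; the summand
    [1] pays for the batch with which it first does so. *)
Lemma sum_arrival_share_le (R : realType) D n (I : instance R D n) d t (s : R) :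
  0 < s <= load I d t ->
  \sum_(j in alive I t | s <= arrival_load I d j) arrival_share I d j
    <= 1 + ln (load I d t / s).
Proof.
(* If [s] lies above the load at the previous time (or there is none), all the
   terms have denominator [load I d t]. *)
have recent u : 0 < s <= load I d u ->
    (forall j, j \in alive I u -> s <= arrival_load I d j ->
       arrival I j = u) ->
    \sum_(j in alive I u | s <= arrival_load I d j) arrival_share I d j
      <= 1 + ln (load I d u / s).
  move=> /andP[s0 su] H; have u0 := lt_le_trans s0 su.
  apply: (@le_trans _ _ 1); last by rewrite lerDl ln_ge0 // ler_pdivlMr // mul1r.
  rewrite (eq_bigr (fun j => alpha I j d / load I d u)); last first.
    by move=> j /andP[ju sj]; rewrite /arrival_share /arrival_load H.
  rewrite -mulr_suml ler_pdivrMr // mul1r /load.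
  rewrite [leRHS](bigID (fun j => s <= arrival_load I d j)) /= lerDl.
  by apply: sumr_ge0 => *; exact: alpha_ge0.
elim: t => [|t IHt].
  by move=> st; apply: recent => // j; rewrite -arrival_le leqn0 => /eqP.
move=> st; have [lt_s|le_s] := ltP (load I d t) s.
  apply: recent => // j; rewrite -arrival_le leq_eqVlt => /orP[/eqP //|].
  rewrite ltnS arrival_le => /(arrival_load_le d) le1 le2.
  by have := lt_le_trans lt_s (le_trans le2 le1); rewrite ltxx.
case/andP: st => s0 _; have t0 := lt_le_trans s0 le_s.
have t10 : 0 < load I d t.+1 := lt_le_trans t0 (load_le I d (leqnSn t)).
have lnE : ln (load I d t.+1 / s) =
    ln (load I d t / s) + ln (load I d t.+1 / load I d t).
  rewrite -lnM ?posrE ?divr_gt0 //; congr ln.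
  by rewrite [RHS]mulrC mulrA divfK ?gt_eqF.
(* Jobs alive at [t] fall under the induction hypothesis; newcomers share the denominator
   [load I d t.+1]. *)
rewrite lnE addrA big_mkcondr (big_setID (alive I t)) /=.
rewrite (finset.setIidPr (alive_subS I t)) -big_mkcondr /=.
apply: lerD; first by apply: IHt; rewrite s0 le_s.
apply: le_trans (one_sub_div_le_ln t0 t10).
rewrite (load_split I d (leqnSn t)) addrAC subrr add0r -load_split //.
rewrite mulr_suml; apply: ler_sum => j; rewrite inE -!arrival_le -ltnNge.
move=> /andP[lt_tj le_jt]; have arrE : arrival I j = t.+1.
  by apply/eqP; rewrite eqn_leq le_jt.
case: ifP => _; first by rewrite /arrival_share /arrival_load arrE.
by rewrite divr_ge0 ?alpha_ge0 ?(ltW t10).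
Qed.

(** The finite steps cost [6] by [step_cost]; the infinite one costs [n / T m <= 1], since every
    share is at most [1]. *)
Lemma sum_share_step_le (R : realType) D n (I : instance R D n) m d t :
  n%:R <= threshold R m ->
  \sum_(j in alive I t)
     arrival_share I d j * step m (load I d t / arrival_load I d j) <= 7.
Proof.
move=> le_nT; have := load_ge0 I d t; rewrite le_eqVlt => /predU1P[S0|S_gt0].
  rewrite big1 // => j jt; rewrite /arrival_share.
  have /eqP -> : alpha I j d == 0.
    by rewrite eq_le alpha_ge0 S0 alpha_le_load.
  by rewrite !mul0r.
have flat : \sum_(j in alive I t) arrival_share I d j / threshold R m <= 1.
  rewrite -mulr_suml ler_pdivrMr ?threshold_gt0 // mul1r.
  apply: le_trans le_nT; apply: le_trans (_ : \sum_(j in alive I t) 1 <= _).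
    by apply: ler_sum => j _; exact: arrival_share_le1.
  by rewrite sumr_const ler_nat -[leqRHS]card_ord max_card.
under eq_bigr => j _ do rewrite /step mulrDr mulr_sumr.
rewrite big_split /= exchange_big /= (_ : 7 = 6 + 1); last by ring.
apply: lerD flat.
apply: le_trans (step_cost R m); apply: ler_sum => i _.
under eq_bigr => j _ do rewrite mulrA.
rewrite -mulr_suml ler_pM2r ?invr_gt0 ?threshold_gt0 //.
have T0 := threshold_gt0 R i.+1; have T1 := threshold_ge1 R i.+1.
(* Step [i] is active exactly for positive arrival loads of at least this [s], and [load I d t / s]
   is the threshold itself. *)
have := @sum_arrival_share_le R D n I d t (load I d t / threshold R i.+1).
rewrite divr_gt0 // ler_pdivrMr // ler_peMr ?(ltW S_gt0) // => /(_ isT).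
rewrite invf_div mulrCA divff ?gt_eqF // mulr1; apply: le_trans.
rewrite [leRHS]big_mkcondr; apply: ler_sum => j jt.
have := load_ge0 I d (arrival I j); rewrite -/(arrival_load I d j).
rewrite le_eqVlt => /predU1P[a0|a_gt0].
  by rewrite /arrival_share -a0 invr0 !mulr0 mul0r; case: ifP.
rewrite ler_pdivrMr // [threshold R i.+1 * _]mulrC -ler_pdivrMr //.
by case: ifP; rewrite ?mulr1 ?mulr0.
Qed.

(** * The policy: online, feasible, near the fair amounts *)

Definition step_policy (R : realType) D n m : policy R D n := fun I t j d =>
  7^-1 * (arrival_share I d j * step m (load I d t / arrival_load I d j)).

Lemma step_policy_online (R : realType) D n m : online (@step_policy R D n m).
Proof.
move=> t I I' [eq_alive eq_alpha] j d jt.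
have jt' : j \in alive I' t by rewrite -eq_alive.
have eq_load s : (s <= t)%N -> load I d s = load I' d s.
  move=> le_st; rewrite /load -eq_alive //; apply: eq_bigr => k ks.
  exact/eq_alpha/(fintype.subsetP (alive_sub I le_st)).
(* Both first alive times are at most [t], where the two histories agree. *)
have eq_arrival : arrival I j = arrival I' j.
  apply/eqP; rewrite eqn_leq; apply/andP; split.
    by rewrite arrival_le eq_alive ?arrival_le // -arrival_le.
  by rewrite arrival_le -eq_alive ?arrival_le // -arrival_le.
rewrite /step_policy /arrival_share /arrival_load -eq_arrival eq_alpha //.
by rewrite !eq_load // arrival_le.
Qed.

Lemma step_policy_ge0 (R : realType) D n m (I : instance R D n) t j d :
  0 <= step_policy m I t j d.
Proof.
rewrite mulr_ge0 ?invr_ge0 ?ler0n //.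
exact: mulr_ge0 (arrival_share_ge0 I d j) (step_ge0 _ _).
Qed.

Lemma step_policy_feasible (R : realType) D n m (I : instance R D n) :
  n%:R <= threshold R m -> feasible I (step_policy m I).
Proof.
move=> le_nT; split=> [t j d _|t d]; first exact: step_policy_ge0.
by rewrite -mulr_sumr mulrC ler_pdivrMr ?ltr0n // mul1r sum_share_step_le.
Qed.

Lemma le_step_policy (R : realType) D n m (I : instance R D n) t j d :
  j \in alive I t -> 7^-1 * prop_fair I t j d <= step_policy m I t j d.
Proof.
move=> jt; rewrite /step_policy /prop_fair ler_pM2l ?invr_gt0 ?ltr0n //.
rewrite -/(load I d t) /arrival_share.
have := alpha_le_arrival_load I d j; have := arrival_load_le d jt.
have := load_ge0 I d (arrival I j); rewrite -/(arrival_load I d j).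
rewrite le_eqVlt => /predU1P[a0|a_gt0 le_aS _].
  rewrite -a0 => _ al0; have /eqP -> : alpha I j d == 0.
    by rewrite eq_le al0 alpha_ge0.
  by rewrite !mul0r.
have S_gt0 := lt_le_trans a_gt0 le_aS.
rewrite -mulrA ler_wpM2l ?alpha_ge0 //.
(* The arrival load cancels, leaving the fair denominator [load I d t]. *)
apply: le_trans (_ : (arrival_load I d j)^-1 * (load I d t / arrival_load I d j)^-1 <= _).
  by rewrite invf_div mulrA mulVf ?gt_eqF ?mul1r.
rewrite ler_pM2l ?invr_gt0 // le_inv_step // ler_pdivlMr // mul1r //.
Qed.

(** Exponents summing to [1] make the rate homogeneous of degree one, and nonnegative ones make it
    monotone. *)
Lemma rate_scale_le (R : realType) D (a x y : 'I_D -> R) (c : R) :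
  0 < c -> (forall d, 0 <= a d) -> \sum_(d < D) a d = 1 ->
  (forall d, 0 <= x d) -> (forall d, c * x d <= y d) ->
  c * rate a x <= rate a y.
Proof.
move=> c_gt0 a_ge0 a_sum x_ge0 le_xy.
have -> : c = \prod_(d < D) c `^ a d.
  rewrite -{1}[c]powRr1 ?(ltW c_gt0) // -[in LHS]a_sum.
  apply: (@big_morph _ _ (powR c) 1 *%R 0 +%R _ (powRr0 c)) => r s.
  by rewrite powRD // (gt_eqF c_gt0) implybT.
rewrite /rate -big_split /=; apply: ler_prod => d _.
rewrite -powRM ?(ltW c_gt0) // powR_ge0 ge0_ler_powR // nnegrE.
  by rewrite mulr_ge0 ?(ltW c_gt0).
by apply: le_trans (le_xy d); rewrite mulr_ge0 ?(ltW c_gt0).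
Qed.

(** * Counting disruptions *)

(** Counting by a relation avoids choosing one crossed threshold per disruption. *)
Lemma card_le_of_rel (A B : finType) (S : {set A}) (r : A -> B -> bool) :
  (forall a, a \in S -> exists b, r a b) ->
  (forall a a' b, r a b -> r a' b -> a = a') -> (#|S| <= #|B|)%N.
Proof.
have Some_inj : injective (@Some A) by move=> a a' [].
move=> tot inj; rewrite -(card_imset _ Some_inj) -cardsT.
apply: leq_trans (leq_imset_card (fun b => [pick a | r a b]) [set: B]).
apply/subset_leq_card/fintype.subsetP => _ /imsetP[a /tot[b rab] ->].
apply/imsetP; exists b => //; case: pickP => [a' ra'b|/(_ a)]; last by rewrite rab.
by congr Some; exact: inj rab ra'b.
Qed.

(** A disruption is charged to a threshold that [ratio j d] crosses; as this ratio never decreases,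
    it crosses each of the [m] thresholds at most once. *)
Lemma step_policy_disruptions (R : realType) D n m (I : instance R D n) T :
  (#|disruptions I (step_policy m I) T| <= n * D * m)%N.
Proof.
pose ratio (j : 'I_n) d t := load I d t / arrival_load I d j.
have ratio_le j d s t : (s <= t)%N -> ratio j d s <= ratio j d t.
  by move=> le_st; rewrite ler_wpM2r ?invr_ge0 ?load_ge0 ?load_le.
pose r (p : 'I_n * 'I_D * 'I_T) (q : 'I_n * 'I_D * 'I_m) :=
  (p.1 == q.1) &&
  (ratio p.1.1 p.1.2 p.2 <= threshold R q.2.+1 < ratio p.1.1 p.1.2 p.2.+1)%R.
rewrite -[n in leqRHS]card_ord -[D in leqRHS]card_ord -[m in leqRHS]card_ord.
rewrite -!card_prod; apply: (@card_le_of_rel _ _ _ r).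
  move=> [[j d] t]; rewrite inE => /andP[_ neq].
  have [i Hi] : exists i : 'I_m,
      (ratio j d t <= threshold R i.+1 < ratio j d t.+1)%R.
    apply: step_crossing; first exact: ratio_le.
    by apply: contraNneq neq => eq_step; rewrite /step_policy -/(ratio _ _ _) eq_step.
  by exists (j, d, i); rewrite /r eqxx.
move=> [[j d] t] [[j' d'] t'] [[j0 d0] i] /andP[/eqP /= [-> ->] /andP[le1 lt1]].
case/andP=> /eqP /= [-> ->] /andP[le2 lt2]; congr (_, _); apply: val_inj => /=.
case: (ltngtP t t') => // lt_t.
- by have := lt_le_trans lt1 (le_trans (ratio_le j0 d0 _ _ lt_t) le2); rewrite ltxx.
- by have := lt_le_trans lt2 (le_trans (ratio_le j0 d0 _ _ lt_t) le1); rewrite ltxx.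
Qed.

Theorem mainTheorem6 (R : realType) :
  exists c C : R, 1 <= c /\ 0 < C /\
    forall D n : nat, (1 <= D)%N -> (1 <= n)%N ->
      exists P : policy R D n, online P /\
        forall I : instance R D n,
          feasible I (P I) /\
          (forall t j, j \in alive I t ->
             c^-1 * rate (alpha I j) (prop_fair I t j)
               <= rate (alpha I j) (P I t j)) /\
          (forall T : nat,
             #|disruptions I (P I) T|%:R
               <= C * n%:R * D%:R * (logstar (n%:R : R))%:R).
Proof.
(* The constant [7] undoes the factor [7^-1] of the policy. *)
exists 7, 1; split; first by rewrite ler1n.
split=> // D n _ _; pose m := logstar (n%:R : R).
have le_nT : n%:R <= threshold R m.
  apply: le_trans (le_tower_logstar _) _.
  by rewrite /threshold expr2 ler_peMr ?ler0n ?tower_ge1.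
exists (@step_policy R D n m); split; first exact: step_policy_online.
move=> I; split; first exact: step_policy_feasible.
split=> [t j jt|T].
  apply: rate_scale_le; rewrite ?invr_gt0 ?ltr0n ?alpha_sum1 //.
  - exact: alpha_ge0.
  - by move=> d; rewrite divr_ge0 ?alpha_ge0 ?load_ge0.
  - by move=> d; exact: le_step_policy.
by rewrite mul1r -!natrM ler_nat step_policy_disruptions.
Qed.
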